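(* Let $\rho_d(0)$ be a given target density operator and $\mathcal{M}$ the manifold of density operators isospectral with $\rho_d(0)$. Every critical point $(\rho_1,\rho_2)$ of the function $V(\rho_1,\rho_2)=\frac12\mathrm{Tr}[(\rho_1-\rho_2)^2]$ on $\mathcal{M}\times\mathcal{M}$ satisfies $[\rho_1,\rho_2]=0$, and thus belongs to the LaSalle invariant set $E$.
   Context: A density operator is a positive semidefinite Hermitian $n\times n$ matrix of trace $1$. $[A,B]=AB-BA$. $H_0,H_1$ are fixed Hermitian $n\times n$ matrices. Consider the system on $\mathcal{M}\times\mathcal{M}$: $\dot\rho=-i[H_0+f(\rho,\rho_d)H_1,\rho]$, $\dot\rho_d=-i[H_0,\rho_d]$, $f(\rho,\rho_d)=\mathrm{Tr}([-iH_1,\rho]\rho_d)$. The LaSalle invariant set $E$ is the set of $(\rho_1,\rho_2)\in\mathcal{M}\times\mathcal{M}$ such that $\dot V(\rho(t),\rho_d(t))=0$ for all $t$ along the solution with $(\rho(0),\rho_d(0))=(\rho_1,\rho_2)$. *)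

(* Defs.v *)
From HB Require Import structures.
From mathcomp Require Import all_boot all_order all_algebra.
From mathcomp Require Import complex.
From mathcomp Require Import boolp classical_sets reals topology normedtype derive.
Import Order.TTheory GRing.Theory Num.Theory.
Import numFieldNormedType.Exports.

Set Implicit Arguments.
Unset Strict Implicit.
Unset Printing Implicit Defensive.

Local Open Scope classical_set_scope.
Local Open Scope sesquilinear_scope.
Local Open Scope ring_scope.
Local Open Scope complex_scope.

Definition commutator (K : pzRingType) (n : nat) (A B : 'M[K]_n) : 'M[K]_n :=
  A *m B - B *m A.

Section DensityOperators.
Context {R : realType} {n : nat}.
Implicit Types A B rho : 'M[R[i]]_n.

(* In R[i], 0 <= z says that z is real and nonnegative. *)
Definition positive_semidefinite A : Prop :=
  forall v : 'cV[R[i]]_n, 0 <= (v^t* *m A *m v) 0 0.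

Definition density_operator rho : Prop :=
  [/\ rho \is hermsymmx, positive_semidefinite rho & \tr rho = 1].

(* Equality of spectra counted with multiplicity. *)
Definition isospectral A B : Prop := char_poly A = char_poly B.

Definition isospectral_densities (rho0 : 'M[R[i]]_n) : set 'M[R[i]]_n :=
  [set rho | density_operator rho /\ isospectral rho rho0].

(* The trace is a complex number which is real on Hermitian matrices (lyapunovE
   below); taking its real part only makes the function R-valued. *)
Definition lyapunov (p : 'M[R[i]]_n * 'M[R[i]]_n) : R :=
  complex.Re (\tr ((p.1 - p.2) *m (p.1 - p.2))) / 2.

Lemma lyapunovE A B : A \is hermsymmx -> B \is hermsymmx ->
  (lyapunov (A, B))%:C = 2^-1 * \tr ((A - B) *m (A - B)).
Proof.
move=> hA hB; have hAB : A - B = (A - B)^t*.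
  move/is_hermitianmxP: hA; move/is_hermitianmxP: hB.
  rewrite !expr0 !scale1r => hB hA.
  by rewrite linearB /= map_mxB -hA -hB.
have htr : \tr ((A - B) *m (A - B)) \is Num.real.
  apply: ger0_real; rewrite {2}hAB; apply: sumr_ge0 => i _.
  rewrite mxE; apply: sumr_ge0 => j _.
  by rewrite [((A - B)^t*) j i]mxE [((A - B)^T) j i]mxE mul_conjC_ge0.
rewrite /lyapunov rmorphM /= RRe_real // mulrC; congr (_ * _).
by rewrite fmorphV rmorph_nat.
Qed.

End DensityOperators.

Section Curves.
Context {R : realType} {n : nat}.
Implicit Types g : R -> 'M[R[i]]_n.

(* R[i] carries no normed-module structure over R, so derivatives with respect
   to real time are taken on the real and imaginary parts of the entries. *)
Definition is_derive_mx g (t : R) (D : 'M[R[i]]_n) : Prop :=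
  forall i j,
    is_derive t 1 (fun s => complex.Re (g s i j)) (complex.Re (D i j)) /\
    is_derive t 1 (fun s => complex.Im (g s i j)) (complex.Im (D i j)).

Definition smooth_fun (f : R -> R) : Prop :=
  forall (k : nat) (t : R), derivable (derive1n k f) t 1.

Definition smooth_mx g : Prop :=
  forall i j, smooth_fun (fun s => complex.Re (g s i j)) /\
              smooth_fun (fun s => complex.Im (g s i j)).

(* For a submanifold S of pairs of matrices, the tangent vectors to S at p are
   the velocities at p of the smooth curves drawn on S, so the differential of F
   vanishes on the tangent space at p iff F has zero derivative along all of
   these curves. *)
Definition critical_point (S : set ('M[R[i]]_n * 'M[R[i]]_n))
    (F : 'M[R[i]]_n * 'M[R[i]]_n -> R) (p : 'M[R[i]]_n * 'M[R[i]]_n) : Prop :=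
  S p /\
  forall g1 g2 : R -> 'M[R[i]]_n,
    smooth_mx g1 -> smooth_mx g2 -> (forall t, S (g1 t, g2 t)) ->
    (g1 0, g2 0) = p ->
    is_derive (0 : R) 1 (fun t => F (g1 t, g2 t)) 0.

End Curves.

Section ControlledSystem.
Context {R : realType} {n : nat}.
Variables (H0 H1 rho0 : 'M[R[i]]_n).

Definition feedback (rho rhod : 'M[R[i]]_n) : R[i] :=
  \tr (commutator (- 'i *: H1) rho *m rhod).

Definition is_solution (p : 'M[R[i]]_n * 'M[R[i]]_n)
    (s : R -> 'M[R[i]]_n * 'M[R[i]]_n) : Prop :=
  [/\ s 0 = p,
      forall t, (isospectral_densities rho0 `*` isospectral_densities rho0) (s t),
      forall t, is_derive_mx (fun u => (s u).1) t
        (- 'i *: commutator (H0 + feedback (s t).1 (s t).2 *: H1) (s t).1) &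
      forall t, is_derive_mx (fun u => (s u).2) t
        (- 'i *: commutator H0 (s t).2)].

(* [unique] asserts existence as well as uniqueness, so that s is "the" solution
   starting from p. *)
Definition lasalle_invariant_set : set ('M[R[i]]_n * 'M[R[i]]_n) :=
  [set p | (isospectral_densities rho0 `*` isospectral_densities rho0) p /\
           exists2 s, unique (is_solution p) s &
             forall t : R, is_derive t 1 (fun u => lyapunov (s u)) 0].

End ControlledSystem.

(* Main.v *)
Require Import Defs.
From mathcomp Require Import all_boot all_order all_algebra.
From mathcomp Require Import complex.
From mathcomp Require Import boolp classical_sets reals topology normedtype.
From mathcomp Require Import sequences derive realfun exp trigo.
From mathcomp Require Import ring.
Import Order.TTheory GRing.Theory Num.Theory.
Import numFieldNormedType.Exports.

Set Implicit Arguments.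
Unset Strict Implicit.
Unset Printing Implicit Defensive.

Local Open Scope classical_set_scope.
Local Open Scope sesquilinear_scope.
Local Open Scope ring_scope.
Local Open Scope complex_scope.

(* If C := [rho1, rho2], then i C is Hermitian and t |-> e^{tC} rho1 e^{-tC} is
   a curve on the isospectral manifold along which V has as derivative at t = 0
   the squared Frobenius norm of C; so C = 0 at a critical point.

   When [rho1, rho2] = 0, conjugating both by U = e^{-i t H0} keeps the pair
   commuting, so the feedback vanishes along this curve: it solves the
   controlled system, and V is constant on it by unitary invariance.  For
   uniqueness, let D be the (Hermitian) deviation of another solution and
   W := tr (D D).  For the second component W' = 0.  For the first one, W' is
   twice the product of the feedback, which is linear in D because it vanishes
   on commuting pairs, and of another linear functional of D, so |W'| <= K W
   and Gronwall's lemma gives W = 0. *)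

(** * Trace identities for commutators *)

Section CommutatorCalculus.
Context {K : comPzRingType} {n : nat}.
Implicit Types (A B C D : 'M[K]_n) (c d : K).

Lemma commutatorxx A : commutator A A = 0.
Proof. exact: subrr. Qed.

Lemma commutatorDl A B C :
  commutator (A + B) C = commutator A C + commutator B C.
Proof. by rewrite /commutator mulmxDl mulmxDr opprD addrACA. Qed.

Lemma commutatorDr A B C :
  commutator A (B + C) = commutator A B + commutator A C.
Proof. by rewrite /commutator mulmxDl mulmxDr opprD addrACA. Qed.

Lemma commutatorZl c A B : commutator (c *: A) B = c *: commutator A B.
Proof. by rewrite /commutator -scalemxAl -scalemxAr scalerBr. Qed.

Lemma mxtrace_commutatorA A B C :
  \tr (A *m commutator B C) = \tr (commutator A B *m C).
Proof.
rewrite /commutator mulmxBr mulmxBl !raddfB /= !mulmxA; congr (_ - _).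
by rewrite mxtrace_mulC mulmxA.
Qed.

(** Invariance of the trace form under commutators, combined with cyclicity of the trace. At a
    critical point it turns the derivative of V into a trace of [C *m C]. *)
Lemma mxtrace_commutator_rot A B C :
  \tr (A *m commutator B C) = \tr (B *m commutator C A).
Proof.
by rewrite mxtrace_commutatorA (mxtrace_mulC _ C) (mxtrace_commutatorA C)
  (mxtrace_mulC _ B).
Qed.

Lemma mxtrace_commutator_eq0 A B : \tr (A *m commutator B A) = 0.
Proof.
by rewrite mxtrace_commutatorA mxtrace_mulC mxtrace_commutatorA commutatorxx
  mul0mx mxtrace0.
Qed.

(** The [B] contribution is [\tr (A *m commutator B C)], which vanishes for a commuting pair. This
    makes the feedback linear in the deviation [D] from [B]. *)
Lemma mxtrace_commutatorDl A B C D : commutator B C = 0 ->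
  \tr (commutator A (D + B) *m C) = \tr (D *m commutator C A).
Proof.
move=> BC; rewrite -mxtrace_commutatorA commutatorDl BC addr0.
exact: mxtrace_commutator_rot.
Qed.

(** Here [A] is the drift, [B] the control, [C] the free solution, [D] the deviation from it and [d]
    the feedback value, so the left side is tr (D D'). Every term where [D] occurs both outside and
    inside the commutator has trace zero; only the control acting on [C] survives. *)
Lemma mxtrace_commutator_perturb A B C D c d :
  \tr (D *m (c *: commutator (A + d *: B) (D + C) - commutator (c *: A) C))
  = d * \tr (D *m commutator (c *: B) C).
Proof.
have -> : c *: commutator (A + d *: B) (D + C) - commutator (c *: A) C
    = commutator (c *: A) D + d *: commutator (c *: B) (D + C).
  rewrite commutatorDl scalerDr -(commutatorZl c A) (commutatorDr (c *: A)).
  by rewrite (addrAC _ (c *: _)) addrK !commutatorZl !scalerA mulrC.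
rewrite commutatorDr mulmxDr mxtraceD mxtrace_commutator_eq0 add0r.
rewrite -scalemxAr mxtraceZ mulmxDr mxtraceD mxtrace_commutator_eq0.
by rewrite add0r.
Qed.

(** The uncontrolled case [d = 0]: two solutions of the free equation stay at constant Frobenius
    distance. *)
Lemma mxtrace_commutatorB A B C c :
  \tr ((B - C) *m (c *: commutator A B - commutator (c *: A) C)) = 0.
Proof.
have := mxtrace_commutator_perturb A 0 C (B - C) c 0.
by rewrite scale0r addr0 subrK mul0r.
Qed.

End CommutatorCalculus.

(** * Hermitian matrices, Frobenius norm and unitary conjugation *)

Section ConjugateTranspose.
Context {R : realType} {n : nat}.
Implicit Types A B U : 'M[R[i]]_n.

Lemma hermsymmxP A : reflect (A^t* = A) (A \is hermsymmx).
Proof.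
by apply: (iffP (is_hermitianmxP _ _ _)); rewrite expr0 scale1r => /esym.
Qed.

Lemma trmxC_mul m p q (A : 'M[R[i]]_(m, p)) (B : 'M[R[i]]_(p, q)) :
  (A *m B)^t* = B^t* *m A^t*.
Proof. by rewrite trmx_mul map_mxM. Qed.

Lemma trmxCB A B : (A - B)^t* = A^t* - B^t*.
Proof. by rewrite linearB /= map_mxB. Qed.

Lemma trmxCZ c A : (c *: A)^t* = c^* *: A^t*.
Proof. by rewrite linearZ /= map_mxZ. Qed.

Lemma hermsymmxB A B : A \is hermsymmx -> B \is hermsymmx ->
  A - B \is hermsymmx.
Proof.
by move=> /hermsymmxP hA /hermsymmxP hB; apply/hermsymmxP; rewrite trmxCB hA hB.
Qed.

Lemma trmxC_commutator A B : A \is hermsymmx -> B \is hermsymmx ->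
  (commutator A B)^t* = - commutator A B.
Proof.
by move=> /hermsymmxP hA /hermsymmxP hB; rewrite trmxCB !trmxC_mul hA hB opprB.
Qed.

Lemma mxtrace_mulmx_trC A : \tr (A *m A^t*) = \sum_i \sum_j `|A i j| ^+ 2.
Proof.
apply: eq_bigr => i _; rewrite mxE; apply: eq_bigr => j _.
by rewrite !mxE normCK.
Qed.

Lemma mxtrace_mulmx_trC_ge0 A : 0 <= \tr (A *m A^t*).
Proof.
by rewrite mxtrace_mulmx_trC; do 2![apply: sumr_ge0 => ? _]; exact: exprn_ge0.
Qed.

Lemma mxtrace_mulmx_trC_eq0 A : \tr (A *m A^t*) = 0 -> A = 0.
Proof.
rewrite mxtrace_mulmx_trC pair_bigA /= => h; apply/matrixP=> i j; rewrite mxE.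
have := psumr_eq0P (fun k _ => exprn_ge0 2 (normr_ge0 _)) h.
by move=> /(_ (i, j) isT) /eqP /=; rewrite expf_eq0 /= normr_eq0 => /eqP.
Qed.

(** Over the polynomial ring, X - U A V factors as U (X - A) V, and det U det V = 1. *)
Lemma char_poly_conj A (U V : 'M[R[i]]_n) : U *m V = 1%:M ->
  char_poly (U *m A *m V) = char_poly A.
Proof.
move=> UV.
have UVP : map_mx polyC U *m map_mx polyC V = 1%:M.
  by rewrite -map_mxM UV map_mx1.
rewrite /char_poly.
have -> : char_poly_mx (U *m A *m V)
    = map_mx polyC U *m char_poly_mx A *m map_mx polyC V.
  rewrite /char_poly_mx mulmxBr mulmxBl !map_mxM; congr (_ - _).
  by rewrite scalar_mxC -mulmxA UVP mulmx1.
by rewrite !det_mulmx mulrAC -det_mulmx UVP det1 mul1r.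
Qed.

(** Keeps curves of unitary conjugates on the manifold; positivity at [v] is positivity of [rho] at
    U* v. *)
Lemma isospectral_densities_conj rho0 rho U :
  U \is unitarymx -> isospectral_densities rho0 rho ->
  isospectral_densities rho0 (U *m rho *m U^t*).
Proof.
move=> hU [[/hermsymmxP herm psd tr1] iso].
have /unitarymxP UV := hU.
have VU : U^t* *m U = 1%:M by apply: mulmx1C.
split; last by rewrite /isospectral char_poly_conj.
split.
- by apply/hermsymmxP; rewrite !trmxC_mul trmxCK herm mulmxA.
- move=> v; have := psd (U^t* *m v).
  by rewrite trmxC_mul trmxCK !mulmxA.
- by rewrite mxtrace_mulC mulmxA VU mul1mx.
Qed.

End ConjugateTranspose.

(** * Derivatives of complex functions of real time *)

Section ComplexDerivative.
Context {R : realType}.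
Implicit Types (f g : R -> R[i]) (t : R) (c d : R[i]).

(** The scalar form of [is_derive_mx], to which it reduces entry by entry. *)
Definition is_deriveC f t d : Prop :=
  is_derive t 1 (fun s => complex.Re (f s)) (complex.Re d) /\
  is_derive t 1 (fun s => complex.Im (f s)) (complex.Im d).

Lemma is_deriveC_cst c t : is_deriveC (fun=> c) t 0.
Proof. by split; exact: is_derive_cst. Qed.

Lemma is_deriveCD f g t df dg : is_deriveC f t df -> is_deriveC g t dg ->
  is_deriveC (fun s => f s + g s) t (df + dg).
Proof.
move=> [f1 f2] [g1 g2]; split.
- have -> : (fun s => complex.Re (f s + g s)) =
    (fun s => complex.Re (f s) + complex.Re (g s)).
    by apply/funext => s /=; case: (f s) (g s) => ? ? [].
  apply: is_derive_eq (is_deriveD f1 g1) _.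
  by case: (df) (dg) => ? ? [].
- have -> : (fun s => complex.Im (f s + g s)) =
    (fun s => complex.Im (f s) + complex.Im (g s)).
    by apply/funext => s /=; case: (f s) (g s) => ? ? [].
  apply: is_derive_eq (is_deriveD f2 g2) _.
  by case: (df) (dg) => ? ? [].
Qed.

Lemma is_deriveCM f g t df dg : is_deriveC f t df -> is_deriveC g t dg ->
  is_deriveC (fun s => f s * g s) t (df * g t + f t * dg).
Proof.
move=> [f1 f2] [g1 g2]; split.
- have -> : (fun s => complex.Re (f s * g s)) =
    (fun s => complex.Re (f s) * complex.Re (g s)
              - complex.Im (f s) * complex.Im (g s)).
    by apply/funext => s /=; case: (f s) (g s) => ? ? [].
  apply: is_derive_eq (is_deriveB (is_deriveM f1 g1) (is_deriveM f2 g2)) _.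
  rewrite /GRing.scale /=.
  by case: (df) (dg) (f t) (g t) => ? ? [? ?] [? ?] [? ?] /=; ring.
- have -> : (fun s => complex.Im (f s * g s)) =
    (fun s => complex.Re (f s) * complex.Im (g s)
              + complex.Im (f s) * complex.Re (g s)).
    by apply/funext => s /=; case: (f s) (g s) => ? ? [].
  apply: is_derive_eq (is_deriveD (is_deriveM f1 g2) (is_deriveM f2 g1)) _.
  rewrite /GRing.scale /=.
  by case: (df) (dg) (f t) (g t) => ? ? [? ?] [? ?] [? ?] /=; ring.
Qed.

Lemma is_deriveC_eq f t d d' : is_deriveC f t d -> d = d' -> is_deriveC f t d'.
Proof. by move=> h <-. Qed.

Lemma is_deriveC_sum (I : finType) (f : I -> R -> R[i]) t (d : I -> R[i]) :
  (forall k, is_deriveC (f k) t (d k)) ->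
  is_deriveC (fun s => \sum_k f k s) t (\sum_k d k).
Proof.
move=> h; elim: (index_enum I) => [|k r IH].
  by rewrite big_nil; under eq_fun do rewrite big_nil; exact: is_deriveC_cst.
rewrite big_cons; under eq_fun do rewrite big_cons.
exact: is_deriveCD.
Qed.

Lemma is_deriveC_conj f t d :
  is_deriveC f t d -> is_deriveC (fun s => (f s)^*) t d^*.
Proof.
move=> [f1 f2]; split.
  have -> : (fun s => complex.Re (f s)^*) = (fun s => complex.Re (f s)).
    by apply/funext => s; case: (f s).
  by case: (d) f1.
have -> : (fun s => complex.Im (f s)^*) = (fun s => - complex.Im (f s)).
  by apply/funext => s; case: (f s).
by apply: is_derive_eq (is_deriveN f2) _; case: (d).
Qed.

(** The phase e^{ix}, given by Euler's formula. *)
Definition cexpi (x : R) : R[i] := cos x +i* sin x.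

Lemma cexpi0 : cexpi 0 = 1.
Proof. by rewrite /cexpi cos0 sin0. Qed.

Lemma cexpi_mulC (x : R) : cexpi x * (cexpi x)^* = 1.
Proof.
apply/eqP; rewrite eq_complex /= mulrN opprK -!expr2 cos2Dsin2 eqxx /=.
by rewrite mulrN mulrC addNr.
Qed.

Lemma is_deriveC_cexpi (a t : R) :
  is_deriveC (fun s => cexpi (a * s)) t ('i * a%:C * cexpi (a * t)).
Proof.
have hm : is_derive t 1 (fun s : R => a * s) a.
  apply: is_derive_eq (is_deriveZ a (is_derive_id t 1)) _.
  by rewrite /GRing.scale /= mulr1.
split.
- apply: is_derive_eq (is_derive1_comp (is_derive_cos _) hm) _.
  by rewrite /=; ring.
- apply: is_derive_eq (is_derive1_comp (is_derive_sin _) hm) _.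
  by rewrite /=; ring.
Qed.

End ComplexDerivative.

(** * Derivatives of matrix curves *)

Section MatrixDerivative.
Context {R : realType} {n : nat}.
Implicit Types (g h : R -> 'M[R[i]]_n) (t : R) (A B K : 'M[R[i]]_n).

Lemma is_derive_mx_cst A t : is_derive_mx (fun=> A) t 0.
Proof. by move=> i j; rewrite mxE; exact: is_deriveC_cst. Qed.

Lemma is_derive_mx_eq g t A B :
  is_derive_mx g t A -> A = B -> is_derive_mx g t B.
Proof. by move=> h <-. Qed.

Lemma is_derive_mxD g h t A B : is_derive_mx g t A -> is_derive_mx h t B ->
  is_derive_mx (fun s => g s + h s) t (A + B).
Proof.
move=> hg hh i j; rewrite mxE.
under [X in is_derive _ _ X]eq_fun do rewrite mxE.
under [X in _ /\ is_derive _ _ X _]eq_fun do rewrite mxE.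
exact: (is_deriveCD (hg i j) (hh i j)).
Qed.

Lemma is_derive_mxM g h t A B : is_derive_mx g t A -> is_derive_mx h t B ->
  is_derive_mx (fun s => g s *m h s) t (A *m h t + g t *m B).
Proof.
move=> hg hh i j; rewrite -/(is_deriveC (fun s => (g s *m h s) i j) t _).
under eq_fun do rewrite mxE.
rewrite !mxE -big_split /=; apply: is_deriveC_sum => k.
exact: (is_deriveCM (hg i k) (hh k j)).
Qed.

Lemma is_derive_mxMl A g t B : is_derive_mx g t B ->
  is_derive_mx (fun s => A *m g s) t (A *m B).
Proof.
move=> hg; apply: is_derive_mx_eq (is_derive_mxM (is_derive_mx_cst A t) hg) _.
by rewrite mul0mx add0r.
Qed.

Lemma is_derive_mxMr A g t B : is_derive_mx g t B ->
  is_derive_mx (fun s => g s *m A) t (B *m A).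
Proof.
move=> hg; apply: is_derive_mx_eq (is_derive_mxM hg (is_derive_mx_cst A t)) _.
by rewrite mulmx0 addr0.
Qed.

Lemma is_derive_mxN g t A : is_derive_mx g t A ->
  is_derive_mx (fun s => - g s) t (- A).
Proof.
move=> /(is_derive_mxMl (- 1%:M)); rewrite mulNmx mul1mx.
by under eq_fun do rewrite mulNmx mul1mx.
Qed.

Lemma is_derive_mxB g h t A B : is_derive_mx g t A -> is_derive_mx h t B ->
  is_derive_mx (fun s => g s - h s) t (A - B).
Proof. by move=> hg /is_derive_mxN; exact: is_derive_mxD. Qed.

Lemma is_derive_mx_trC g t A : is_derive_mx g t A ->
  is_derive_mx (fun s => (g s)^t*) t (A^t*).
Proof.
move=> hg i j; rewrite -/(is_deriveC (fun s => (g s)^t* i j) t _) !mxE.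
under eq_fun do rewrite !mxE.
exact: (is_deriveC_conj (hg j i)).
Qed.

Lemma is_deriveC_trace g t A : is_derive_mx g t A ->
  is_deriveC (fun s => \tr (g s)) t (\tr A).
Proof. by move=> hg; apply: is_deriveC_sum => i; exact: hg. Qed.

Lemma is_derive_mx_commutator K g t A : is_derive_mx g t A ->
  is_derive_mx (fun s => commutator K (g s)) t (commutator K A).
Proof.
move=> hg; apply: is_derive_mxB; first exact: is_derive_mxMl.
exact: is_derive_mxMr.
Qed.

Lemma is_derive_Retrace_sqr g t A : is_derive_mx g t A ->
  is_derive t 1 (fun s => complex.Re (\tr (g s *m g s)))
    (complex.Re (\tr (g t *m A)) *+ 2).
Proof.
move=> hg; have [h _] := is_deriveC_trace (is_derive_mxM hg hg).
move: h; rewrite linearD /= (mxtrace_mulC A) -mulr2n.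
by case: (\tr _) => a b /=; rewrite mulr2n.
Qed.

(* The derivatives of g are the iterates of the constant linear map [K, -]
   applied to g. *)
Lemma smooth_mx_commutator K g :
  (forall t, is_derive_mx g t (commutator K (g t))) -> smooth_mx g.
Proof.
move=> hg.
have hk k t : is_derive_mx (fun s => iter k (commutator K) (g s)) t
    (iter k.+1 (commutator K) (g t)).
  elim: k t => [|k IH] t; first exact: hg.
  by rewrite iterS /=; exact: is_derive_mx_commutator.
move=> i j; split=> k t.
- have -> : derive1n k (fun s => complex.Re (g s i j)) =
     (fun s => complex.Re (iter k (commutator K) (g s) i j)).
    elim: k => [//|k IH]; rewrite derive1nS IH; apply/funext => s.
    by have [[_ h] _] := hk k s i j; rewrite derive1E h.
  by have [[]] := hk k t i j.
- have -> : derive1n k (fun s => complex.Im (g s i j)) =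
     (fun s => complex.Im (iter k (commutator K) (g s) i j)).
    elim: k => [//|k IH]; rewrite derive1nS IH; apply/funext => s.
    by have [_ [_ h]] := hk k s i j; rewrite derive1E h.
  by have [_ []] := hk k t i j.
Qed.

End MatrixDerivative.

(** * Gronwall estimates *)

Section Gronwall.
Context {R : realType}.

(** The product of [W] with the integrating factor e^{-Kt} has nonpositive derivative, hence stays
    below its initial value 0. *)
Lemma gronwall_ge0 (W W' : R -> R) (K : R) :
  (forall t : R, is_derive t 1 W (W' t)) -> (forall t, W' t <= K * W t) ->
  W 0 = 0 -> forall t, 0 <= t -> W t <= 0.
Proof.
move=> hW hK W0 t t0.
pose h s := W s * expR (- K * s).
have hm (s : R) : is_derive s 1 (fun u : R => - K * u) (- K).
  apply: is_derive_eq (is_deriveZ (- K) (is_derive_id s 1)) _.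
  by rewrite /GRing.scale /= mulr1.
have hh (s : R) : is_derive s 1 h ((W' s - K * W s) * expR (- K * s)).
  apply: is_derive_eq
    (is_deriveM (hW s) (is_derive1_comp (is_derive_expR _) (hm s))) _.
  by rewrite /GRing.scale /=; ring.
have : h t <= h 0.
  apply: (@ler0_derive1_nincry _ _ 0) => // [s _|].
  - by have [_ e] := hh s; rewrite derive1E e mulr_le0_ge0 ?expR_ge0// subr_le0.
  - apply/continuous_subspaceT => s.
    exact/differentiable_continuous/derivable1_diffP.
by rewrite /h W0 mul0r pmulr_lle0 ?expR_gt0.
Qed.

Lemma gronwall (W W' : R -> R) (K : R) :
  (forall t : R, is_derive t 1 W (W' t)) -> (forall t, `|W' t| <= K * W t) ->
  (forall t, 0 <= W t) -> W 0 = 0 -> forall t, W t = 0.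
Proof.
move=> hW hK W_ge0 W0 t; apply/eqP; rewrite eq_le W_ge0 andbT.
case: (leP 0 t) => t0.
  apply: (gronwall_ge0 hW _ W0 t0) => s.
  exact: le_trans (ler_norm _) (hK s).
(* Negative times reduce to positive ones by time reversal, which is where the lower bound on [W']
   enters. *)
have hN (s : R) : is_derive s 1 (fun u : R => W (- u)) (- W' (- s)).
  apply: is_derive_eq (is_derive1_comp (hW (- s)) (is_deriveNid s 1)) _.
  by rewrite mulrN1.
rewrite -(opprK t); apply: (gronwall_ge0 hN) => [s||].
- by apply: le_trans (hK (- s)); rewrite -normrN ler_norm.
- by rewrite oppr0.
- by rewrite oppr_ge0 ltW.
Qed.

(** For Hermitian [D], W = tr (D D) is the squared Frobenius norm, so W = 0 forces D = 0. Since W' =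
    2 Re tr (D D'), the scalar lemma applies with the constant 2K. *)
Lemma hermitian_gronwall n (D D' : R -> 'M[R[i]]_n) (K : R) :
  (forall t, D t \is hermsymmx) -> (forall t, is_derive_mx D t (D' t)) ->
  (forall t, `|\tr (D t *m D' t)| <= K%:C * \tr (D t *m D t)) ->
  D 0 = 0 -> forall t, D t = 0.
Proof.
move=> hD hD' hK D0 t.
have tr_ge0 s : 0 <= \tr (D s *m D s).
  by rewrite -{2}(hermsymmxP _ (hD s)) mxtrace_mulmx_trC_ge0.
have trE s : \tr (D s *m D s) = (complex.Re (\tr (D s *m D s)))%:C.
  by rewrite RRe_real // ger0_real.
suff W0 : complex.Re (\tr (D t *m D t)) = 0.
  apply: mxtrace_mulmx_trC_eq0.
  by rewrite (hermsymmxP _ (hD t)) trE W0.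
apply: (@gronwall (fun s => complex.Re (\tr (D s *m D s)))
  (fun s => complex.Re (\tr (D s *m D' s)) *+ 2) (K *+ 2)) => [s|s|s|].
- exact: is_derive_Retrace_sqr.
- rewrite normrMn mulrnAl lerMn2r /= -lecR rmorphM /= -trE.
  exact: le_trans (normc_ge_Re _) (hK s).
- by rewrite -ler0c -trE.
- by rewrite D0 mul0mx mxtrace0.
Qed.

End Gronwall.

(** * Bounds in the entrywise norm *)

(** Cauchy-Schwarz against the constant 1: expand the square into a double sum and bound each
    product by the mean of the two squares. *)
Lemma sqr_sum_le (K : numFieldType) (I : finType) (a : I -> K) :
  (forall k, 0 <= a k) ->
  (\sum_k a k) ^+ 2 <= #|I|%:R * \sum_k a k ^+ 2.
Proof.
move=> a0; rewrite expr2 mulr_suml.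
apply: (@le_trans _ _ (\sum_k \sum_l (a k ^+ 2 + a l ^+ 2) / 2)).
  apply: ler_sum => k _; rewrite mulr_sumr; apply: ler_sum => l _.
  by apply: real_leif_mean_square; exact: ger0_real.
under eq_bigr do rewrite -mulr_suml big_split /= sumr_const.
rewrite -mulr_suml big_split /= sumr_const sumrMnl -mulr2n -[_ *+ 2]mulr_natr.
by rewrite mulfK ?pnatr_eq0 // mulr_natl.
Qed.

Section EntrywiseNorm.
Context {R : realType} {n : nat}.
Implicit Types A B D J sigma : 'M[R[i]]_n.

Definition mxnorm1 A : R[i] := \sum_i \sum_j `|A i j|.

Lemma mxnorm1_ge0 A : 0 <= mxnorm1 A.
Proof. by apply: sumr_ge0 => i _; exact: sumr_ge0. Qed.

Lemma mxnorm1B A B : mxnorm1 (A - B) <= mxnorm1 A + mxnorm1 B.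
Proof.
rewrite -big_split; apply: ler_sum => i _ /=.
rewrite -big_split; apply: ler_sum => j _ /=.
by rewrite !mxE ler_normB.
Qed.

Lemma mxnorm1M A B : mxnorm1 (A *m B) <= mxnorm1 A * mxnorm1 B.
Proof.
rewrite mulr_suml; apply: ler_sum => i _.
apply: (@le_trans _ _ (\sum_j \sum_k `|A i k| * `|B k j|)).
  apply: ler_sum => j _; rewrite mxE; apply: le_trans (ler_norm_sum _ _ _) _.
  by apply: ler_sum => k _; rewrite normrM.
rewrite exchange_big /= mulr_suml; apply: ler_sum => k _.
(* The sum over row [k] of [B] is at most the sum over all rows. *)
rewrite -mulr_sumr ler_wpM2l // /mxnorm1 [leRHS](bigD1 k) //= lerDl.
by apply: sumr_ge0 => l _; exact: sumr_ge0.
Qed.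

Lemma mxtrace_le_mxnorm1 A : `|\tr A| <= mxnorm1 A.
Proof.
apply: le_trans (ler_norm_sum _ _ _) _; apply: ler_sum => i _.
by rewrite [leRHS](bigD1 i) //= lerDl; exact: sumr_ge0.
Qed.

Lemma mxnorm1_commutator A B :
  mxnorm1 (commutator A B) <= (mxnorm1 A * mxnorm1 B) *+ 2.
Proof.
apply: le_trans (mxnorm1B _ _) _; rewrite mulr2n lerD ?mxnorm1M //.
by rewrite mulrC mxnorm1M.
Qed.

Lemma mxnorm1_sqr A :
  mxnorm1 A ^+ 2 <= (n * n)%:R * \tr (A *m A^t*).
Proof.
rewrite /mxnorm1 pair_bigA /=.
apply: le_trans (sqr_sum_le _) _ => [k|]; first exact: normr_ge0.
rewrite card_prod card_ord mxtrace_mulmx_trC.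
by rewrite pair_bigA.
Qed.

Lemma mxnorm1_unitary A : A \is unitarymx -> mxnorm1 A <= (n * n)%:R.
Proof.
move=> /unitarymxP hA.
rewrite -(@ler_pXn2r _ 2) ?nnegrE ?mxnorm1_ge0 ?ler0n //.
apply: le_trans (mxnorm1_sqr A) _.
rewrite hA mxtrace1 expr2 ler_wpM2l ?ler0n // ler_nat.
by case: (n) => // m; rewrite leq_pmulr.
Qed.

Lemma mxtrace_mul_le A B : `|\tr (A *m B)| <= mxnorm1 A * mxnorm1 B.
Proof. exact: le_trans (mxtrace_le_mxnorm1 _) (mxnorm1M _ _). Qed.

(** Each factor is linear in [D], so the product is bounded by the square of [mxnorm1 D], hence by
    tr (D D). The constant involves [c1] and [c2] only, so that it can be chosen independent of
    time. *)
Lemma mxtrace_commutators_le D J sigma1 sigma2 (c1 c2 : R[i]) :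
  D \is hermsymmx -> mxnorm1 sigma1 <= c1 -> mxnorm1 sigma2 <= c2 ->
  `|\tr (D *m commutator sigma2 J) * \tr (D *m commutator J sigma1)|
  <= (mxnorm1 J * c2) *+ 2 * ((mxnorm1 J * c1) *+ 2) * (n * n)%:R
     * \tr (D *m D).
Proof.
move=> hD h1 h2.
have c1_ge0 := le_trans (mxnorm1_ge0 _) h1.
have c2_ge0 := le_trans (mxnorm1_ge0 _) h2.
have est A c : mxnorm1 A <= c -> `|\tr (D *m A)| <= mxnorm1 D * c.
  move=> hA; apply: le_trans (mxtrace_mul_le _ _) _.
  by rewrite ler_wpM2l ?mxnorm1_ge0.
have est2 : mxnorm1 (commutator sigma2 J) <= (mxnorm1 J * c2) *+ 2.
  apply: le_trans (mxnorm1_commutator _ _) _.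
  by rewrite lerMn2r /= mulrC ler_wpM2l ?mxnorm1_ge0.
have est1 : mxnorm1 (commutator J sigma1) <= (mxnorm1 J * c1) *+ 2.
  apply: le_trans (mxnorm1_commutator _ _) _.
  by rewrite lerMn2r /= ler_wpM2l ?mxnorm1_ge0.
rewrite normrM.
apply: le_trans
  (ler_pM (normr_ge0 _) (normr_ge0 _) (est _ _ est2) (est _ _ est1)) _.
rewrite mulrACA -expr2 mulrC -[leRHS]mulrA ler_wpM2l //.
  by rewrite mulr_ge0 // mulrn_wge0 // mulr_ge0 ?mxnorm1_ge0.
by have := mxnorm1_sqr D; rewrite (hermsymmxP _ hD).
Qed.

End EntrywiseNorm.

(** * The unitary group generated by a Hermitian matrix *)

Section Propagator.
Context {R : realType} {n : nat}.
Variable H : 'M[R[i]]_n.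

(** This is e^{-itH}, computed in an eigenbasis. The phase [cexpi] takes a real argument, hence the
    real part, which is the eigenvalue itself when [H] is Hermitian. *)
Definition propagator (t : R) : 'M[R[i]]_n :=
  let P := spectralmx H in
  P^t* *m diag_mx (\row_j cexpi (- complex.Re (spectral_diag H 0 j) * t)) *m P.

Lemma propagator0 : propagator 0 = 1%:M.
Proof.
have /unitarymxP/mulmx1C PP := spectral_unitarymx H.
rewrite /propagator; under eq_mx do rewrite mulr0 cexpi0.
have -> : diag_mx (\row__ 1) = 1%:M :> 'M[R[i]]_n.
  by apply/matrixP => i j; rewrite !mxE.
by rewrite mulmx1 PP.
Qed.

Lemma propagator_unitary t : propagator t \is unitarymx.
Proof.
have hP := spectral_unitarymx H.
apply: mul_unitarymx (hP); apply: mul_unitarymx.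
  by rewrite trmxC_unitary.
apply/unitarymxP/matrixP => i j; rewrite mul_diag_mx !mxE.
have [->|ij] := eqVneq i j; first by rewrite !mulr1n cexpi_mulC.
by rewrite !mulr0n rmorph0 mulr0.
Qed.

Hypothesis hH : H \is hermsymmx.

Lemma is_derive_propagator t :
  is_derive_mx propagator t (- 'i *: (H *m propagator t)).
Proof.
have hP := spectral_unitarymx H.
have /orthomx_spectralP := hermitian_normalmx hH.
rewrite invmx_unitary // => HE.
have hd j : (complex.Re (spectral_diag H 0 j))%:C = spectral_diag H 0 j.
  rewrite RRe_real //.
  by move/mxOverP: (hermitian_spectral_diag_real hH); exact.
(* In the eigenbasis the equation splits into scalar equations for the phases. *)
pose E s := diag_mx (\row_j cexpi (- complex.Re (spectral_diag H 0 j) * s)).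
have hE : is_derive_mx E t (- 'i *: (diag_mx (spectral_diag H) *m E t)).
  move=> i j; rewrite -/(is_deriveC (fun s => E s i j) t _).
  rewrite mul_diag_mx !mxE; under eq_fun do rewrite !mxE.
  have [->|ij] := eqVneq i j; last first.
    by rewrite !mulr0n !mulr0; exact: is_deriveC_cst.
  rewrite !mulr1n; apply: is_deriveC_eq (is_deriveC_cexpi _ _) _.
  by rewrite rmorphN /= hd; ring.
apply: is_derive_mx_eq (is_derive_mxMr _ (is_derive_mxMl _ hE)) _.
rewrite -scalemxAr -scalemxAl; congr (_ *: _).
have -> : H *m propagator t = (spectralmx H)^t* *m diag_mx (spectral_diag H)
    *m spectralmx H *m propagator t by rewrite -HE.
by rewrite /propagator !mulmxA mulmxtVK.
Qed.

End Propagator.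

(** * Free evolution by unitary conjugation *)

Section Evolution.
Context {R : realType} {n : nat}.
Variable H : 'M[R[i]]_n.
Implicit Types A B rho : 'M[R[i]]_n.

Definition evolution rho (t : R) : 'M[R[i]]_n :=
  propagator H t *m rho *m (propagator H t)^t*.

Lemma evolution_time0 rho : evolution rho 0 = rho.
Proof.
by rewrite /evolution propagator0 trmx1 map_mx1 mulmx1 mul1mx.
Qed.

Lemma isospectral_densities_evolution rho0 rho t :
  isospectral_densities rho0 rho ->
  isospectral_densities rho0 (evolution rho t).
Proof. exact/isospectral_densities_conj/propagator_unitary. Qed.

Lemma evolutionM A B t :
  evolution A t *m evolution B t = evolution (A *m B) t.
Proof.
rewrite /evolution; move: (propagator H t) (propagator_unitary H t) => U hU.
by rewrite !mulmxA mulmxKtV.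
Qed.

Lemma evolutionB A B t : evolution (A - B) t = evolution A t - evolution B t.
Proof. by rewrite /evolution mulmxBr mulmxBl. Qed.

Lemma mxtrace_evolution A t : \tr (evolution A t) = \tr A.
Proof.
have /unitarymxP/mulmx1C UU := propagator_unitary H t.
by rewrite /evolution mxtrace_mulC mulmxA UU mul1mx.
Qed.

Lemma commutator_evolution A B t :
  commutator (evolution A t) (evolution B t) = evolution (commutator A B) t.
Proof. by rewrite /commutator !evolutionM evolutionB. Qed.

(** The bound is uniform in [t], as a Gronwall constant requires. *)
Lemma mxnorm1_evolution rho t :
  mxnorm1 (evolution rho t) <= (n * n)%:R * mxnorm1 rho * (n * n)%:R.
Proof.
have hU := propagator_unitary H t.
apply: le_trans (mxnorm1M _ _) _.
rewrite ler_pM ?mxnorm1_ge0 ?mxnorm1_unitary ?trmxC_unitary //.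
apply: le_trans (mxnorm1M _ _) _.
by rewrite ler_wpM2r ?mxnorm1_ge0 ?mxnorm1_unitary.
Qed.

Hypothesis hH : H \is hermsymmx.

Lemma is_derive_evolution rho t :
  is_derive_mx (evolution rho) t (commutator (- 'i *: H) (evolution rho t)).
Proof.
have hU := is_derive_propagator hH t.
apply: is_derive_mx_eq
  (is_derive_mxM (is_derive_mxMr rho hU) (is_derive_mx_trC hU)) _.
rewrite /commutator /evolution; move: (propagator H t) => U.
rewrite trmxCZ trmxC_mul (hermsymmxP _ hH) rmorphN /= conjCi opprK.
by rewrite -!scalemxAl -!scalemxAr !mulmxA -scaleNr opprK.
Qed.

End Evolution.

(** * Critical points of V are commuting pairs *)

Section CriticalPoints.
Context {R : realType} {n : nat}.
Implicit Types rho : 'M[R[i]]_n.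

Lemma critical_point_commute (rho0 rho1 rho2 : 'M[R[i]]_n) :
  critical_point (isospectral_densities rho0 `*` isospectral_densities rho0)
    lyapunov (rho1, rho2) -> commutator rho1 rho2 = 0.
Proof.
move=> [[/= h1 h2] hcrit].
have [[herm1 _ _] _] := h1; have [[herm2 _ _] _] := h2.
set C := commutator rho1 rho2.
pose H := 'i *: C.
have hH : H \is hermsymmx.
  apply/hermsymmxP; rewrite trmxCZ trmxC_commutator // scalerN -scaleNr.
  by rewrite conjCi opprK.
have HC : - 'i *: H = C.
  by rewrite scalerA mulNr -expr2 sqrCi opprK scale1r.
have dg t := is_derive_evolution hH rho1 t; rewrite HC in dg.
have smooth1 := smooth_mx_commutator dg.
have smooth2 : smooth_mx (fun _ : R => rho2).
  (* A constant curve is a flow with generator 0. *)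
  apply: (@smooth_mx_commutator _ _ 0) => t.
  by rewrite /commutator mul0mx mulmx0 subr0; exact: is_derive_mx_cst.
have [_ crit] := hcrit _ _ smooth1 smooth2
  (fun t => conj (isospectral_densities_evolution H t h1) h2)
  (congr1 (pair^~ rho2) (evolution_time0 H rho1)).
have dV : is_derive (0 : R) 1 (fun t => lyapunov (evolution H rho1 t, rho2))
    (complex.Re (\tr ((rho1 - rho2) *m commutator C rho1))).
  have -> : (fun t => lyapunov (evolution H rho1 t, rho2)) =
      (fun t => 2^-1 * complex.Re (\tr ((evolution H rho1 t - rho2) *m
                                        (evolution H rho1 t - rho2)))).
    by apply/funext => t; rewrite /lyapunov mulrC.
  apply: is_derive_eq (is_deriveZ 2^-1 (is_derive_Retrace_sqr
    (is_derive_mxB (dg 0) (is_derive_mx_cst rho2 0)))) _.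
  rewrite subr0 evolution_time0 /GRing.scale /=.
  by rewrite -[complex.Re _ *+ 2]mulr_natl mulKf ?pnatr_eq0.
have [_] := dV; rewrite crit.
rewrite mulmxBl linearB /= mxtrace_commutator_eq0 sub0r.
rewrite (mxtrace_commutator_rot rho2) -/C.
have -> : - \tr (C *m C) = \tr (C *m C^t*).
  by rewrite (trmxC_commutator herm1 herm2) mulmxN raddfN.
move=> /esym trC; apply: mxtrace_mulmx_trC_eq0.
(* Only the real part is known to vanish; the trace is nonnegative, hence real. *)
by rewrite -[LHS]RRe_real ?trC // ger0_real ?mxtrace_mulmx_trC_ge0.
Qed.

End CriticalPoints.

(** * Commuting pairs lie in the LaSalle invariant set *)

Section Solution.
Context {R : realType} {n : nat}.
Variables (H0 H1 rho0 rho1 rho2 : 'M[R[i]]_n).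
Hypotheses (hH0 : H0 \is hermsymmx) (hC : commutator rho1 rho2 = 0).
Hypotheses (h1 : isospectral_densities rho0 rho1)
           (h2 : isospectral_densities rho0 rho2).

Let s (t : R) := (evolution H0 rho1 t, evolution H0 rho2 t).

Lemma commutator_free t :
  commutator (evolution H0 rho1 t) (evolution H0 rho2 t) = 0.
Proof. by rewrite commutator_evolution hC /evolution mulmx0 mul0mx. Qed.

Lemma free_evolution_is_solution : is_solution H0 H1 rho0 (rho1, rho2) s.
Proof.
split=> [|t|t|t] /=.
- by rewrite /s !evolution_time0.
- by split; exact: isospectral_densities_evolution.
(* The feedback is the trace of -i [H1] times the commutator of the two states, which is zero
   here. *)
- rewrite /feedback -mxtrace_commutatorA commutator_free mulmx0 mxtrace0.
  rewrite scale0r addr0 -commutatorZl.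
  exact: is_derive_evolution.
- by rewrite -commutatorZl; exact: is_derive_evolution.
Qed.

Lemma free_evolution_unique s' :
  is_solution H0 H1 rho0 (rho1, rho2) s' -> s = s'.
Proof.
move=> [s'0 s'S dr dq].
have hermB r rho t : isospectral_densities rho0 r ->
    isospectral_densities rho0 rho -> r - evolution H0 rho t \is hermsymmx.
  by move=> [[hr _ _] _] /(isospectral_densities_evolution H0 t) [[he _ _] _];
    exact: hermsymmxB.
(* The target equation does not involve the first component, so it is settled first, with Gronwall
   constant 0; the result is then inserted into the feedback. *)
have eq2 t : (s' t).2 = evolution H0 rho2 t.
  apply/eqP; rewrite -subr_eq0; apply/eqP; move: t.
  apply: (hermitian_gronwall (K := 0) _
    (fun t => is_derive_mxB (dq t) (is_derive_evolution hH0 rho2 t))) => [t|t|].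
  - by apply: hermB; case: (s'S t).
  - by rewrite (mxtrace_commutatorB H0 (s' t).2) normr0 mul0r.
  - by rewrite s'0 evolution_time0 subrr.
suff eq1 t : (s' t).1 = evolution H0 rho1 t.
  by apply/funext => t; rewrite /s -eq1 -eq2 -surjective_pairing.
apply/eqP; rewrite -subr_eq0; apply/eqP; move: t.
have hD t : (s' t).1 - evolution H0 rho1 t \is hermsymmx.
  by apply: hermB; case: (s'S t).
(* [c] is the uniform bound on the free evolution, and [K] below is the constant of
   [mxtrace_commutators_le] for the generator -i [H1]. *)
pose c (rho : 'M[R[i]]_n) := (n * n)%:R * mxnorm1 rho * (n * n)%:R.
pose j := mxnorm1 (- 'i *: H1).
pose K := (j * c rho2) *+ 2 * ((j * c rho1) *+ 2) * (n * n)%:R.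
have c_ge0 rho : 0 <= c rho by rewrite !mulr_ge0 ?mxnorm1_ge0.
have K_ge0 : 0 <= K.
  by rewrite mulr_ge0 // mulr_ge0 // mulrn_wge0 // mulr_ge0 ?mxnorm1_ge0.
(* The Gronwall constant must be real; [K] is nonnegative, so its real part embeds back to [K]. *)
apply: (hermitian_gronwall (K := complex.Re K) hD
    (fun t => is_derive_mxB (dr t) (is_derive_evolution hH0 rho1 t))) => [t|].
- rewrite RRe_real ?ger0_real // eq2.
  move: (hD t) (commutator_free t) (mxnorm1_evolution H0 rho1 t)
    (mxnorm1_evolution H0 rho2 t).
  move: (evolution H0 rho1 t) (evolution H0 rho2 t) => e1 e2 hDt e12 le1 le2.
  move: ((s' t).1) hDt => r hDt.
  (* Both factors below are linear in the deviation r - e1: the feedback because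
     it vanishes at (e1, e2), the other one because tr (D [J, D]) = 0. *)
  have := mxtrace_commutator_perturb H0 H1 e1 (r - e1) (- 'i)
    (feedback H1 r e2).
  rewrite subrK => ->.
  have -> : feedback H1 r e2 = \tr ((r - e1) *m commutator e2 (- 'i *: H1)).
    by rewrite -(mxtrace_commutatorDl _ _ e12) subrK.
  exact: mxtrace_commutators_le.
- by rewrite s'0 evolution_time0 subrr.
Qed.

Lemma commuting_lasalle : lasalle_invariant_set H0 H1 rho0 (rho1, rho2).
Proof.
split; first exact: (conj h1 h2).
exists s => [|t].
  split; [exact: free_evolution_is_solution | exact: free_evolution_unique].
have -> : (fun u => lyapunov (s u)) = (fun=> lyapunov (rho1, rho2)).
  apply/funext => u.
  by rewrite /lyapunov /= -!evolutionB evolutionM mxtrace_evolution.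
exact: is_derive_cst.
Qed.

End Solution.

Theorem mainTheorem5 (R : realType) (n : nat) (H0 H1 : 'M[R[i]]_n)
    (rhod0 rho1 rho2 : 'M[R[i]]_n)
    (hH0 : H0 \is hermsymmx) (hH1 : H1 \is hermsymmx)
    (hrhod0 : density_operator rhod0)
    (hcrit : critical_point
       (isospectral_densities rhod0 `*` isospectral_densities rhod0)
       lyapunov (rho1, rho2)) :
  commutator rho1 rho2 = 0 /\
  lasalle_invariant_set H0 H1 rhod0 (rho1, rho2).
Proof.
have hC := critical_point_commute hcrit.
have [[h1 h2] _] := hcrit.
by split; last exact: commuting_lasalle.
Qed.
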